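(* Let $m \geq 1$ be an integer and let $n \geq 2^m$ be an even integer. Then the hypercube $Q_n$ can be decomposed into cycles $C_1, C_2, \dots, C_r$, each of length $2^m n$, where $r = 2^{n-1-m}$, such that (I) every $C_i$ contains $2^m$ edges $e_{i1}, e_{i2}, \dots, e_{i2^m}$ such that the graph $C_i - \{e_{i1}, \dots, e_{i2^m}\}$ has exactly $2^m$ components, each of which is a path of length $n-1$; and (II) the set $M = \{e_{ij} : j = 1, \dots, 2^m;\ i = 1, \dots, r\}$ is a perfect matching of $Q_n$.
   Context: $Q_n$ is the $n$-dimensional hypercube (vertices: binary $n$-tuples; edges: pairs differing in exactly one coordinate). A decomposition into cycles means a partition of the edge set into edge sets of cycles. The length of a cycle or path is its number of edges. A perfect matching is a set of pairwise vertex-disjoint edges covering every vertex. *)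

(* Defs.v *)
From mathcomp Require Import all_boot.

Set Implicit Arguments.
Unset Strict Implicit.
Unset Printing Implicit Defensive.

Definition graph_axiom (T : finType) (V : {set T}) (E : {set {set T}}) :=
  forall e : {set T}, e \in E -> e \subset V /\ #|e| = 2.

Record graph (T : finType) := Graph {
  vset : {set T};
  eset : {set {set T}};
  graphP : graph_axiom vset eset
}.

Definition adj (T : finType) (G : graph T) : rel T :=
  fun x y => [set x; y] \in eset G.

Lemma del_edges_subproof (T : finType) (G : graph T) (F : {set {set T}}) :
  graph_axiom (vset G) (eset G :\: F).
Proof. by move=> e /setDP[eG _]; apply: graphP. Qed.

Definition del_edges (T : finType) (G : graph T) (F : {set {set T}}) : graph T :=
  Graph (@del_edges_subproof T G F).

Lemma induced_subproof (T : finType) (G : graph T) (A : {set T}) :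
  graph_axiom (vset G :&: A) [set e in eset G | e \subset A].
Proof.
by move=> e; rewrite inE subsetI => /andP[/graphP[-> ->] ->].
Qed.

Definition induced (T : finType) (G : graph T) (A : {set T}) : graph T :=
  Graph (@induced_subproof T G A).

(* The vertex sets of the connected components; the component itself, as a    *)
(* graph, is the subgraph induced on such a set.                              *)
Definition components (T : finType) (G : graph T) : {set {set T}} :=
  [set [set y in vset G | connect (adj G) x y] | x in vset G].

(* The edges joining consecutive vertices of the walk x :: p. *)
Definition walk_edges (T : finType) (x : T) (p : seq T) : {set {set T}} :=
  [set e in pairmap (fun a b => [set a; b]) x p].

Definition is_path (T : finType) (G : graph T) : Prop :=
  exists (x : T) (p : seq T),
    [/\ uniq (x :: p),
        vset G = [set y in x :: p]
      & eset G = walk_edges x p].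

Definition is_cycle (T : finType) (G : graph T) : Prop :=
  exists (x : T) (p : seq T),
    [/\ 3 <= size (x :: p),
        uniq (x :: p),
        vset G = [set y in x :: p]
      & eset G = walk_edges x (rcons p x)].

Definition length_of (T : finType) (G : graph T) : nat := #|eset G|.

(* Cycles have at least one edge, so the blocks of the partition are never    *)
(* empty.                                                                     *)
Definition cycle_decomposition (T : finType) (G : graph T) (r : nat)
    (C : 'I_r -> graph T) : Prop :=
  [/\ forall i, is_cycle (C i),
      forall i j, i != j -> [disjoint eset (C i) & eset (C j)]
    & \bigcup_i eset (C i) = eset G].

Definition perfect_matching (T : finType) (G : graph T) (M : {set {set T}}) :
    Prop :=
  [/\ M \subset eset G,
      forall e f, e \in M -> f \in M -> e != f -> [disjoint e & f]
    & forall x, x \in vset G -> exists2 e, e \in M & x \in e].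

Definition cube_edges (n : nat) : {set {set n.-tuple bool}} :=
  [set [set p.1; p.2] | p : n.-tuple bool * n.-tuple bool
     & #|[set i | tnth p.1 i != tnth p.2 i]| == 1].

Lemma hypercube_subproof (n : nat) : graph_axiom [set: n.-tuple bool] (cube_edges n).
Proof.
move=> e /imsetP[[x y]]; rewrite inE /= => xy ->; split; first exact: subsetT.
rewrite cards2; case: (eqVneq x y) xy => // ->.
suff -> : [set i | tnth y i != tnth y i] = set0 by rewrite cards0.
by apply/setP=> i; rewrite !inE eqxx.
Qed.

Definition hypercube (n : nat) : graph (n.-tuple bool) :=
  Graph (@hypercube_subproof n).

(* Main.v *)
(* Let h = m - 1, so that 3h < 2^m <= n. From each even vertex walk through   *)
(* the directions 0, ..., n-1 in turn. These walks partition the edges of the  *)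
(* cube, their last edges are the edges of direction n-1, and they map each    *)
(* even vertex to its antipode, which is again even. This settles m = 1.       *)
(*   For larger m, split the directions below 3h into triples (a, c, b). In a  *)
(* triple, the walks of four even vertices x + <a+b, a+c> can be rerouted      *)
(* together, two of them reading (a, c, a) and the two others (b, c, b): they  *)
(* still use the same edges, and each end vertex moves by a + b. The decision  *)
(* to reroute may depend on all coordinates of x beyond the triple, so the end *)
(* vertex map can be made to run a binary counter with digits x_(n-1) and      *)
(* x_a + x_(n-1), one for each triple. All its orbits have length 2^m, and the *)
(* walks along an orbit concatenate to a closed walk of length 2^m n.          *)
(*   The closed walk is simple: x_a + x_b and, in each direction d that is not *)
(* an a or a b, x_d + x_(n-1) are constant along an orbit, so that a vertex    *)
(* determines its position within its walk, and then the walk.                 *)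

Require Import Defs.
From mathcomp Require Import all_boot zify.

Set Implicit Arguments.
Unset Strict Implicit.
Unset Printing Implicit Defensive.

(** * Cycles made of blocks *)

(** Write m = h + 1 and let triple i be (a, c, b) = (3i, 3i+1, 3i+2); [fire] decides which triples
    are rerouted. Four facts carry the proof. Edges: for any rule [fire i] that reads only
    coordinates beyond triple i, no edge occurs twice in the walks from even vertices
    ([walk_edge_inj]), and counting shows that every edge occurs ([walk_edge_onto]). Orbits: with
    [fire] taken to be [carry], the end vertex map [step] increments a counter of h+1 bits, and
    everything else returns when the counter does. So all orbits have length 2^m ([order_step]), and
    the 2^(n-1) even vertices form 2^(n-1-m) orbits ([step_transversal]). Simplicity: the invariants
    of an orbit keep its closed walk from meeting itself ([walk_simple]). Matching: direction n-1
    lies beyond all triples, so it is used exactly by the last edges of the walks ([dir_last]).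
    Deleting these edges cuts a closed walk into its blocks, which are paths of length n-1
    ([del_components], [del_component_path]). *)

Lemma walk_edges_mkseq (T : finType) (g : nat -> T) q :
  walk_edges (g 0) (mkseq (g \o succn) q) = [set [set g i; g i.+1] | i : 'I_q].
Proof.
apply/setP => e; rewrite inE.
suff -> : pairmap (fun a b => [set a; b]) (g 0) (mkseq (g \o succn) q) =
          mkseq (fun i => [set g i; g i.+1]) q.
  apply/mapP/imsetP => [[i] | [i _ ->]]; last by
    exists (val i); rewrite ?mem_iota ?add0n ?ltn_ord.
  by rewrite mem_iota add0n => iq ->; exists (Ordinal iq).
apply: (@eq_from_nth _ set0); rewrite size_pairmap !size_mkseq // => i iq.
rewrite (nth_pairmap (g 0)) ?size_mkseq // !nth_mkseq //.
by case: i iq => //= i iq; rewrite nth_mkseq // ltnW.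
Qed.

Section BlockCycle.
Variables (T : finType) (N n : nat) (P : nat -> nat -> T).
Hypotheses (n_gt1 : 1 < n) (N_gt1 : 1 < N).
Hypothesis P_next : forall j, P j n = P j.+1 0.
Hypothesis P_closed : P N 0 = P 0 0.
Hypothesis P_inj : forall j k j' k', j < N -> k < n -> j' < N -> k' < n ->
  P j k = P j' k' -> j = j' /\ k = k'.
Let E j k := [set P j k; P j k.+1].
Hypothesis E_inj : forall j k j' k', j < N -> k < n -> j' < N -> k' < n ->
  E j k = E j' k' -> j = j' /\ k = k'.

Definition block_vset := [set P p.1 p.2 | p : 'I_N * 'I_n].
Definition block_eset := [set E p.1 p.2 | p : 'I_N * 'I_n].

Lemma mem_block_vset j k : j < N -> k <= n -> P j k \in block_vset.
Proof.
have P_mem i l : i < N -> l < n -> P i l \in block_vset.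
  by move=> iN ln; apply/imsetP; exists (Ordinal iN, Ordinal ln).
move=> jN; rewrite leq_eqVlt => /orP[/eqP -> | kn]; last exact: P_mem.
rewrite P_next; move: jN; rewrite leq_eqVlt => /orP[/eqP -> | jN]; last by apply: P_mem; lia.
by rewrite P_closed; apply: P_mem; lia.
Qed.

Lemma P_succ_neq j k : j < N -> k < n -> P j k != P j k.+1.
Proof.
move=> jN kn; apply/eqP; have [kn' | kn'] := ltnP k.+1 n.
  by case/P_inj => //; lia.
have -> : k.+1 = n by lia.
rewrite P_next; have [jN' | jN'] := ltnP j.+1 N.
  by case/P_inj => //; lia.
by have -> : j.+1 = N; [lia | rewrite P_closed; case/P_inj; lia].
Qed.

Lemma block_subproof : graph_axiom block_vset block_eset.
Proof.
move=> _ /imsetP[[j k] _ ->] /=; split.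
  by apply/subsetP => z /set2P[] ->; apply: mem_block_vset => //; exact: ltnW.
by rewrite cards2 P_succ_neq.
Qed.

Definition block_cycle : graph T := Graph block_subproof.

Let g i := P (i %/ n) (i %% n).

(** The case k = n is included: the index then opens the next block, and [P_next] identifies the two
    vertices. *)
Lemma block_gE j k : k <= n -> g (j * n + k) = P j k.
Proof.
rewrite leq_eqVlt => /orP[/eqP -> | kn]; rewrite /g.
  by rewrite -mulSnr mulnK 1?ltnW // modnMl P_next.
by rewrite divnMDl ?(ltnW n_gt1) // divn_small // addn0 modnMDl modn_small.
Qed.

Lemma block_gS i : g i.+1 = P (i %/ n) (i %% n).+1.
Proof.
by rewrite {1}(divn_eq i n) -addnS block_gE // ltn_pmod // ltnW.
Qed.

Lemma block_is_cycle : is_cycle block_cycle.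
Proof.
have n_gt0 : 0 < n by lia.
have Nn : 3 < N * n by nia.
have closed : g (N * n) = g 0 by rewrite -[N * n]addn0 block_gE // P_closed /g div0n mod0n.
exists (g 0), (mkseq (g \o succn) (N * n).-1).
have -> : g 0 :: mkseq (g \o succn) (N * n).-1 = mkseq g (N * n).
  rewrite /mkseq -{2}[N * n]prednK; last by lia.
  by rewrite /= -[1]/(1 + 0) iotaDl -map_comp.
have pos i : i < N * n -> i %/ n < N /\ i %% n < n.
  by move=> iNn; rewrite ltn_divLR // ltn_pmod.
split.
- by rewrite size_mkseq ltnW.
- rewrite map_inj_in_uniq ?iota_uniq // => i i'.
  rewrite !mem_iota !add0n => /pos[iN ik] /pos[iN' ik'] /P_inj[] // Ej Ek.
  by rewrite (divn_eq i n) (divn_eq i' n) Ej Ek.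
- apply/setP => z; rewrite inE; apply/imsetP/mapP => [[[j k] _ ->] | [i]] /=.
    exists (j * n + k); last by rewrite block_gE // ltnW.
    by rewrite mem_iota add0n; have := ltn_ord j; have := ltn_ord k; nia.
  rewrite mem_iota add0n => /pos[iN ik] ->.
  by exists (Ordinal iN, Ordinal ik).
have -> : rcons (mkseq (g \o succn) (N * n).-1) (g 0) = mkseq (g \o succn) (N * n).
  case: (N * n) Nn closed => // q _ closed.
  by rewrite mkseqS /= closed.
rewrite walk_edges_mkseq; apply/setP => e; apply/imsetP/imsetP => [[[j k] _ ->] | [i _ ->]] /=.
  have iNn : j * n + k < N * n by have := ltn_ord j; have := ltn_ord k; nia.
  by exists (Ordinal iNn) => //=; rewrite -addnS !block_gE // ltnW.
have [iN ik] := pos i (ltn_ord i).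
by exists (Ordinal iN, Ordinal ik); rewrite //= block_gS.
Qed.

Lemma block_length : length_of block_cycle = N * n.
Proof.
rewrite /length_of /= card_imset ?card_prod ?card_ord // => -[j k] [j' k'] /=.
by case/E_inj => // /val_inj -> /val_inj ->.
Qed.

(** * Deleting the last edge of each block *)

Definition links := [set E j n.-1 | j : 'I_N].

Lemma links_sub j : j < N -> E j n.-1 \in block_eset.
Proof.
move=> jN; have n1 : n.-1 < n by lia.
by apply/imsetP; exists (Ordinal jN, Ordinal n1).
Qed.

Let H := del_edges block_cycle links.
Definition block j := [set P j k | k : 'I_n].

Lemma mem_block j k : k < n -> P j k \in block j.
Proof. by move=> kn; apply/imsetP; exists (Ordinal kn). Qed.

Lemma block_inj j j' z : j < N -> j' < N -> z \in block j -> z \in block j' -> j = j'.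
Proof. by move=> jN jN' /imsetP[k _ ->] /imsetP[k' _] /P_inj[]. Qed.

Lemma eset_del e :
  reflect (exists j k, [/\ j < N, k < n.-1 & e = E j k]) (e \in eset H).
Proof.
apply: (iffP setDP) => [[/imsetP[[j k] _ /= ->] nl] | [j [k [jN kn ->]]]].
  exists j, k; split=> //; rewrite ltn_neqAle -ltnS prednK ?ltn_ord 1?ltnW // andbT.
  by apply: contraNneq nl => ->; apply/imsetP; exists j.
have kn' : k < n by lia.
split; first by apply/imsetP; exists (Ordinal jN, Ordinal kn').
by apply/imsetP => -[j' _] /E_inj[] //; lia.
Qed.

Lemma E_sub_block j k j' : j < N -> k < n.-1 -> j' < N ->
  (E j k \subset block j') = (j == j').
Proof.
move=> jN kn jN'; apply/subsetP/eqP => [sub | <- z /set2P[] ->]; last 2 first.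
- by apply: mem_block; lia.
- by apply: mem_block; lia.
by apply: (@block_inj _ _ (P j k)) => //;
  [apply: mem_block; lia | apply: sub; rewrite !inE eqxx].
Qed.

Lemma del_component j k : j < N -> k < n ->
  [set y in vset H | connect (adj H) (P j k) y] = block j.
Proof.
move=> jN kn.
have sym : connect_sym (adj H) by apply: sym_connect_sym => x y; rewrite /adj setUC.
have from0 l : l < n -> connect (adj H) (P j 0) (P j l).
  elim: l => // l IHl ln; apply: connect_trans (IHl (ltnW ln)) (connect1 _).
  by apply/eset_del; exists j, l; split=> //; lia.
(* Every surviving edge lies inside one block and blocks are disjoint, so adjacency cannot leave a
   block. *)
have closedb : closed (adj H) (mem (block j)).
  apply: intro_closed => // x y /eset_del[j' [l [jN' ln Exy]]] xj.
  have /subsetP sub : [set x; y] \subset block j'.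
    by rewrite Exy E_sub_block.
  rewrite (@block_inj j j' x) //; first by apply: sub; rewrite !inE eqxx orbT.
  by apply: sub; rewrite !inE eqxx.
apply/setP => y; rewrite inE; apply/andP/idP => [[_ /(closed_connect closedb) <-] | ].
  exact: mem_block.
case/imsetP => l _ ->; split; first by apply: mem_block_vset => //; apply: ltnW.
by apply: connect_trans (from0 _ (ltn_ord l)); rewrite sym from0.
Qed.

Lemma del_components : components H = [set block j | j : 'I_N].
Proof.
apply/setP => A; apply/imsetP/imsetP => [[x /imsetP[[j k] _ ->] ->] | [j _ ->]].
  by exists j; rewrite ?del_component.
have n_gt0 : 0 < n by lia.
by exists (P j 0); rewrite ?del_component // mem_block_vset.
Qed.

Lemma card_del_components : #|components H| = N.
Proof.
rewrite del_components card_imset ?card_ord // => j j' Ej; apply/val_inj.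
have n_gt0 : 0 < n by lia.
by apply: (@block_inj j j' (P j 0)); rewrite -?Ej ?mem_block.
Qed.

Lemma del_component_path A : A \in components H ->
  is_path (induced H A) /\ length_of (induced H A) = n - 1.
Proof.
rewrite del_components => /imsetP[j _ ->].
have eset_ind : eset (induced H (block j)) = [set E j k | k : 'I_n.-1].
  apply/setP => e; rewrite inE;
  apply/andP/imsetP => [[/eset_del[j' [k [jN kn ->]]]] | [k _ ->]].
    by rewrite E_sub_block // => /eqP ->; exists (Ordinal kn).
  by rewrite E_sub_block //; split=> //; apply/eset_del; exists j, k.
split; last first.
  rewrite /length_of eset_ind card_imset ?card_ord ?subn1 // => k k'.
  by case/E_inj => //; [have := ltn_ord k; lia | have := ltn_ord k'; lia | move=> _ /val_inj].
exists (P j 0), (mkseq (P j \o succn) n.-1).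
have -> : P j 0 :: mkseq (P j \o succn) n.-1 = mkseq (P j) n.
  rewrite /mkseq -[n in RHS]prednK; last by lia.
  by rewrite /= -[1]/(1 + 0) iotaDl -map_comp.
split.
- rewrite map_inj_in_uniq ?iota_uniq // => k k'; rewrite !mem_iota !add0n => kn kn'.
  by case/P_inj.
- apply/setP => z; rewrite !inE; apply/andP/mapP => [[_ /imsetP[k _ ->]] | [k]].
    by exists (val k); rewrite ?mem_iota ?add0n ?ltn_ord.
  by rewrite mem_iota add0n => kn ->; rewrite mem_block // mem_block_vset // ltnW.
by rewrite walk_edges_mkseq eset_ind.
Qed.

End BlockCycle.

(** * Vertices and edges of the cube *)

Lemma eq_tuple_bits n (x y : n.-tuple bool) :
  (forall c, c < n -> nth false x c = nth false y c) -> x = y.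
Proof.
move=> xy; apply/val_inj/(@eq_from_nth _ false); first by rewrite !size_tuple.
by move=> c; rewrite size_tuple; apply: xy.
Qed.

Definition flip n (d : nat) (x : n.-tuple bool) : n.-tuple bool :=
  [tuple nth false x c (+) (c == d :> nat) | c < n].

Lemma nth_flip n d (x : n.-tuple bool) c :
  c < n -> nth false (flip d x) c = nth false x c (+) (c == d).
Proof. by move=> cn; rewrite -[c]/(val (Ordinal cn)) -tnth_nth tnth_mktuple. Qed.

Lemma flipK n d : involutive (@flip n d).
Proof.
by move=> x; apply: eq_tuple_bits => c cn; rewrite !nth_flip // -addbA addbb addbF.
Qed.

Definition parity n (x : n.-tuple bool) := \big[addb/false]_(c < n) nth false x c.

Lemma parity_flip n d (x : n.-tuple bool) :
  d < n -> parity (flip d x) = ~~ parity x.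
Proof.
move=> dn; rewrite /parity.
under eq_bigr => c _ do rewrite nth_flip //.
suff one : \big[addb/false]_(c < n) (c == d :> nat) = true by rewrite big_split /= one addbT.
rewrite (bigD1 (Ordinal dn)) //= eqxx big1 // => i.
by rewrite -val_eqE /= => /negPf.
Qed.


(** Flipping coordinate 0 exchanges even and odd vertices. *)
Lemma card_even_vertices n : 0 < n -> #|[pred x : n.-tuple bool | ~~ parity x]| = 2 ^ (n - 1).
Proof.
move=> n_gt0.
have odd_even : #|[pred x : n.-tuple bool | parity x]| =
    #|[pred x : n.-tuple bool | ~~ parity x]|.
  rewrite -(card_image (inv_inj (@flipK n 0)) [pred x | ~~ parity x]).
  apply: eq_card => x; rewrite -[x in RHS](flipK 0) mem_image ?inE ?parity_flip ?negbK //.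
  exact: inv_inj (@flipK n 0).
have := cardC [pred x : n.-tuple bool | parity x].
have -> : #|{: n.-tuple bool}| = 2 * 2 ^ (n - 1).
  by rewrite card_tuple card_bool -expnS subn1 prednK.
have -> : #|[predC [pred x : n.-tuple bool | parity x]]| =
    #|[pred x : n.-tuple bool | ~~ parity x]|.
  by apply: eq_card => x; rewrite !inE.
by rewrite odd_even; lia.
Qed.

Lemma flip_neq n d (x : n.-tuple bool) : d < n -> flip d x != x.
Proof.
by move=> dn; apply/eqP => /(congr1 (@parity n)); rewrite parity_flip //; case: parity.
Qed.

Lemma flip_inj_dir n d e (x : n.-tuple bool) : d < n -> flip d x = flip e x -> d = e.
Proof.
move=> dn /(congr1 (fun z : n.-tuple bool => nth false z d)).
by rewrite /= !nth_flip // eqxx => /addbI/esym/eqP.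
Qed.

Lemma cube_edgeP n (e : {set n.-tuple bool}) :
  reflect (exists x d, d < n /\ e = [set x; flip d x]) (e \in cube_edges n).
Proof.
apply: (iffP imsetP) => [[[x y]] | [x [d [dn ->]]]].
  rewrite inE /= => /cards1P[i Ei] ->; exists x, i; split=> //; congr [set _; _].
  apply: eq_tuple_bits => c cn; rewrite nth_flip //.
  have /setP/(_ (Ordinal cn)) := Ei; rewrite !inE !(tnth_nth false) -val_eqE /= => <-.
  by case: nth; case: nth.
exists (x, flip d x) => //; rewrite inE /=; apply/cards1P; exists (Ordinal dn).
apply/setP => c; rewrite !inE !(tnth_nth false) nth_flip // -val_eqE /=.
by case: nth; case: (_ == d).
Qed.

(** An edge determines its direction, and its start up to exchanging the ends; parity later excludes
    the exchange. *)
Lemma flip_edge_inj n d e (x y : n.-tuple bool) : d < n -> e < n ->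
  [set x; flip d x] = [set y; flip e y] ->
  d = e /\ (x = y \/ x = flip e y).
Proof.
move=> dn en E.
have := set21 x (flip d x); have := set22 x (flip d x).
rewrite E => /set2P fx /set2P[xy | xy]; subst x.
  case: fx => [/eqP | /flip_inj_dir]; first by rewrite (negPf (flip_neq _ _)).
  by move=> /(_ dn) ->; auto.
case: fx => [|/eqP]; last by rewrite (negPf (flip_neq _ _)).
by move=> /(congr1 (flip d)); rewrite flipK => /esym/flip_inj_dir ->; auto.
Qed.


(** * The decomposition into paths *)

(* Of the four walks rerouted together in triple i, the two whose start has   *)
(* coordinate 3i+1 set deviate at the first letter, the others at the last.    *)
Definition swap_time n i (x : n.-tuple bool) :=
  if nth false x (3 * i + 1) then 3 * i + 1 else 3 * i + 3.

Section Walk.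
Variables (n h : nat) (fire : nat -> n.-tuple bool -> bool).
Implicit Types x y : n.-tuple bool.

(** From [swap_time] on, a rerouted walk differs from the plain one in both a and b. Swapping at
    time 3i+1 turns the letters (a, c, b) into (b, c, b); swapping at time 3i+3 turns them into (a,
    c, a). *)
Definition swapped x k c :=
  [&& c %/ 3 < h, c %% 3 != 1, fire (c %/ 3) x & swap_time (c %/ 3) x <= k].

Definition walk x k : n.-tuple bool :=
  [tuple nth false x c (+) (c < k) (+) swapped x k c | c < n].

Lemma nth_walk x k c : c < n ->
  nth false (walk x k) c = nth false x c (+) (c < k) (+) swapped x k c.
Proof. by move=> cn; rewrite -[c]/(val (Ordinal cn)) -tnth_nth tnth_mktuple. Qed.

Definition dir x k :=
  if (k %/ 3 < h) && fire (k %/ 3) x then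
    if nth false x (3 * (k %/ 3) + 1) then
      if k %% 3 == 0 then k + 2 else k
    else if k %% 3 == 2 then k - 2 else k
  else k.

Definition walk_edge x k := [set walk x k; walk x k.+1].

Lemma walk0 x : walk x 0 = x.
Proof.
apply: eq_tuple_bits => c cn; rewrite nth_walk // /swapped /swap_time.
case: nth; case: nth; case: fire => /=; lia.
Qed.

Lemma walkS x k : walk x k.+1 = flip (dir x k) (walk x k).
Proof.
apply: eq_tuple_bits => c cn; rewrite nth_flip // !nth_walk // /swapped /dir /swap_time.
have [ck | ck] := eqVneq (c %/ 3) (k %/ 3); [rewrite ck|].
  by case: (nth false x c); case: nth; case: fire => /=; do !case: ifP; lia.
by case: (nth false x c); case: nth; case: nth; case: fire; case: fire => /=;
  do !case: ifP; lia.
Qed.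

Hypothesis h_lt : 3 * h < n.
Hypothesis fire_local : forall i (x y : n.-tuple bool), i < h ->
  (forall c, 3 * i + 3 <= c < n -> nth false x c = nth false y c) ->
  fire i x = fire i y.

Lemma dir_lt x k : k < n -> dir x k < n.
Proof. by rewrite /dir => kn; do !case: ifP; lia. Qed.

Lemma parity_walk x k : k <= n -> parity (walk x k) = parity x (+) odd k.
Proof.
elim: k => [|k IHk] kn; first by rewrite walk0 addbF.
by rewrite walkS parity_flip ?dir_lt // IHk 1?ltnW //= addbN.
Qed.

Lemma walk_passive x k c : c < n -> 3 * h <= c \/ c %% 3 = 1 ->
  nth false (walk x k) c = nth false x c (+) (c < k).
Proof. by move=> cn hc; rewrite nth_walk // /swapped; case: nth; case: fire => /=; lia. Qed.

(** Rerouting complements both coordinates of the pair at once, so their sum evolves as on the plain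
    walk. *)
Lemma walk_pair x k i : i < h ->
  nth false (walk x k) (3 * i) (+) nth false (walk x k) (3 * i + 2) =
  nth false x (3 * i) (+) nth false x (3 * i + 2) (+) (3 * i < k <= 3 * i + 2).
Proof.
move=> ih; rewrite !nth_walk; [|lia|lia]; rewrite /swapped.
have -> : 3 * i %/ 3 = i by lia.
have -> : (3 * i + 2) %/ 3 = i by lia.
have -> : 3 * i %% 3 = 0 by lia.
have -> : (3 * i + 2) %% 3 = 2 by lia.
case: (nth _ _ (3 * i)); case: nth; case: fire; case: (swap_time i x <= k) => /=; lia.
Qed.

Lemma walk_inj k : injective (walk^~ k).
Proof.
move=> x y eq_xy.
have eqc c : c < n -> nth false (walk x k) c = nth false (walk y k) c by rewrite eq_xy.
have eq_passive c : c < n -> 3 * h <= c \/ c %% 3 = 1 -> nth false x c = nth false y c.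
  move=> cn hc; have := eqc c cn; rewrite !walk_passive //; exact: addIb.
(* Triples are recovered from the last one down: [fire] reads only coordinates beyond its triple,
   and [swap_time] only the passive middle coordinate. *)
suff H i : i <= h -> forall c, 3 * (h - i) <= c < n -> nth false x c = nth false y c.
  by apply: eq_tuple_bits => c cn; apply: (H h) => //; rewrite subnn.
elim: i => [|i IHi] ih c hc; first by apply: eq_passive; lia.
have [hc'|hc'] := leqP (3 * (h - i)) c; first by apply: IHi; lia.
have eq_fire : fire (h - i.+1) x = fire (h - i.+1) y.
  by apply: fire_local => [|d hd]; [lia | apply: IHi; lia].
have := eqc c; rewrite !nth_walk; [|lia..]; rewrite /swapped /swap_time.
have -> : c %/ 3 = h - i.+1 by lia.
rewrite eq_fire (eq_passive (3 * (h - i.+1) + 1)); [|lia|lia].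
by move/(_ ltac:(lia))/addIb/addIb.
Qed.

(** * The end vertex map and its invariants *)

Definition step x := walk x n.

Lemma step_inj : injective step. Proof. exact: walk_inj. Qed.

Lemma step_passive x c : c < n -> 3 * h <= c \/ c %% 3 = 1 ->
  nth false (step x) c = ~~ nth false x c.
Proof. by move=> cn hc; rewrite walk_passive // cn addbT. Qed.

Lemma step_pair x i : i < h ->
  nth false (step x) (3 * i) (+) nth false (step x) (3 * i + 2) =
  nth false x (3 * i) (+) nth false x (3 * i + 2).
Proof. move=> ih; have E : (3 * i < n <= 3 * i + 2) = false by lia.
by rewrite walk_pair // E addbF. Qed.

Lemma iter_step_passive x j c : c < n -> 3 * h <= c \/ c %% 3 = 1 ->
  nth false (iter j step x) c = nth false x c (+) odd j.
Proof.
move=> cn hc; elim: j => [|j IHj]; first by rewrite addbF.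
by rewrite iterS step_passive // IHj /= addbN.
Qed.

Lemma iter_step_pair x j i : i < h ->
  nth false (iter j step x) (3 * i) (+) nth false (iter j step x) (3 * i + 2) =
  nth false x (3 * i) (+) nth false x (3 * i + 2).
Proof. by move=> ih; elim: j => // j IHj; rewrite iterS step_pair. Qed.

(** * Partition of the edges of the cube *)

Lemma walk_edgeE x k : walk_edge x k = [set walk x k; flip (dir x k) (walk x k)].
Proof. by rewrite -walkS. Qed.

Lemma walk_edge_cube x k : k < n -> walk_edge x k \in cube_edges n.
Proof.
by move=> kn; apply/cube_edgeP; exists (walk x k), (dir x k); rewrite walk_edgeE dir_lt.
Qed.

Lemma dir_last x k : k < n -> (dir x k == n.-1) = (k == n.-1).
Proof. by rewrite /dir => kn; do !case: ifP; lia. Qed.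

(** Letters at different times can agree only as the first and the last letter of one triple. By
    parity both walks then traverse the edge from the same end, so their starts agree beyond the
    triple and differ in its middle coordinate. Hence both fire or neither does, and in each case
    the two letters differ. *)
Lemma walk_edge_ltF x y k l : k < l < n -> ~~ parity x -> ~~ parity y ->
  walk_edge x k <> walk_edge y l.
Proof.
move=> /andP[kl ln] px py.
have kn : k < n by lia.
rewrite !walk_edgeE => /flip_edge_inj [||eq_d eq_w]; try exact: dir_lt.
have [l3 [kh k3]] : l = k + 2 /\ k %/ 3 < h /\ k = 3 * (k %/ 3).
  by move: eq_d; rewrite /dir; do !case: ifP; lia.
have {}eq_w : walk x k = walk y l.
  case: eq_w => // /(congr1 (@parity n)).
  rewrite parity_flip ?dir_lt // !parity_walk; [|lia..].
  by rewrite l3 oddD addbF (negPf px) (negPf py); case: odd.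
set i := k %/ 3 in kh k3.
have high c : 3 * i + 3 <= c < n -> nth false x c = nth false y c.
  move=> hc; have cn : c < n by lia.
  have := congr1 (fun z : n.-tuple bool => nth false z c) eq_w.
  rewrite /= !nth_walk // /swapped /swap_time.
  case: (nth false x c); case: (nth false y c) => //;
    do 2!case: nth; do 2!case: fire => /=; lia.
have eq_fire := fire_local kh high.
have := congr1 (fun z : n.-tuple bool => nth false z (3 * i + 1)) eq_w.
rewrite /= !walk_passive; [|lia..].
have [-> ->] : (3 * i + 1 < k) = false /\ (3 * i + 1 < l) by lia.
rewrite addbF addbT => eq_c.
move: eq_d; rewrite /dir (_ : l %/ 3 = i); last by lia.
rewrite -/i -eq_fire eq_c; case: fire; case: nth => /=; do !case: ifP; lia.
Qed.

Lemma walk_edge_inj x y k l : ~~ parity x -> ~~ parity y -> k < n -> l < n ->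
  walk_edge x k = walk_edge y l -> x = y /\ k = l.
Proof.
move=> px py kn ln eq_e; have [kl|lk|kl] := ltngtP k l.
- by case: (@walk_edge_ltF x y k l); rewrite ?kl.
- by case: (@walk_edge_ltF y x l k); rewrite ?lk.
split=> //; move: eq_e; rewrite -kl !walk_edgeE => /flip_edge_inj [||_]; try exact: dir_lt.
case=> [/walk_inj -> // | /(congr1 (@parity n))].
rewrite parity_flip ?dir_lt // !parity_walk; [|lia..].
by rewrite (negPf px) (negPf py); case: odd.
Qed.

(* By counting: each edge of the cube has exactly one even end, so there are  *)
(* no more edges than pairs (x, k).                                            *)
Lemma walk_edge_onto e : e \in cube_edges n ->
  exists x k, [/\ ~~ parity x, k < n & e = walk_edge x k].
Proof.
pose even_vertices : {set n.-tuple bool} := [set x | ~~ parity x].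
pose D := setX even_vertices [set: 'I_n].
pose f (p : n.-tuple bool * 'I_n) := walk_edge p.1 p.2.
pose g (p : n.-tuple bool * 'I_n) := [set p.1; flip p.2 p.1].
have sub_f : f @: D \subset cube_edges n.
  by apply/subsetP => _ /imsetP[p _ ->]; apply: walk_edge_cube.
have sub_g : cube_edges n \subset g @: D.
  apply/subsetP => _ /cube_edgeP[x [d [dn ->]]]; apply/imsetP.
  case px: (parity x).
    exists (flip d x, Ordinal dn); first by rewrite !inE /= parity_flip // px.
    by rewrite /g /= flipK setUC.
  by exists (x, Ordinal dn); rewrite ?inE ?px.
have card_f : #|f @: D| = #|D|.
  apply: card_in_imset => -[x k] [y l]; rewrite !inE !andbT /= => px py.
  by case/walk_edge_inj => //= -> /val_inj ->.
have /eqP E : f @: D == cube_edges n.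
  by rewrite eqEcard sub_f card_f (leq_trans (subset_leq_card sub_g)) ?leq_imset_card.
rewrite -E => /imsetP[[x k]]; rewrite !inE andbT /= => px ->.
by exists x, k.
Qed.


(** * Simplicity of the closed walks *)

Hypothesis n_even : ~~ odd n.

Lemma parity_step x : parity (step x) = parity x.
Proof. by rewrite parity_walk // (negPf n_even) addbF. Qed.

Lemma parity_iter_step x j : parity (iter j step x) = parity x.
Proof. by elim: j => // j IHj; rewrite iterS parity_step. Qed.

Lemma walk_simple_ltF x y k l : k < l < n -> parity x = parity y ->
  (forall c, c < n -> 3 * h <= c \/ c %% 3 = 1 ->
    nth false x c (+) nth false x n.-1 = nth false y c (+) nth false y n.-1) ->
  (forall i, i < h -> nth false x (3 * i) (+) nth false x (3 * i + 2) =
    nth false y (3 * i) (+) nth false y (3 * i + 2)) ->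
  walk x k <> walk y l.
Proof.
move=> /andP[kl ln] par pas pair eq_w.
have : odd k = odd l.
  have := congr1 (@parity n) eq_w; rewrite !parity_walk; [|lia..].
  by rewrite par => /addbI.
move=> odd_kl; have kl2 : k.+2 <= l by lia.
have eq_last : nth false x n.-1 = nth false y n.-1.
  have := congr1 (fun z : n.-tuple bool => nth false z n.-1) eq_w.
  have [nk nl] : (n.-1 < k) = false /\ (n.-1 < l) = false by lia.
  by rewrite /= !walk_passive ?nk ?nl ?addbF; [|lia..].
have flippedF c : k <= c < l -> ~ (3 * h <= c \/ c %% 3 = 1).
  move=> ckl hc; have cn : c < n by lia.
  have := congr1 (fun z : n.-tuple bool => nth false z c) eq_w.
  have := pas c cn hc; rewrite eq_last => /addIb eqc.
  by rewrite /= !walk_passive // eqc => /addbI; lia.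
have k1 := flippedF k; have k2 := flippedF k.+1.
have [hk k3] : k %/ 3 < h /\ k = 3 * (k %/ 3) + 2 by lia.
have := congr1 (fun z : n.-tuple bool =>
  nth false z (3 * (k %/ 3)) (+) nth false z (3 * (k %/ 3) + 2)) eq_w.
by rewrite /= !walk_pair // pair // => /addbI; lia.
Qed.

Lemma walk_simple x j j' k l : k < n -> l < n ->
  walk (iter j step x) k = walk (iter j' step x) l ->
  iter j step x = iter j' step x /\ k = l.
Proof.
move=> kn ln eq_w.
have pas i i' c : c < n -> 3 * h <= c \/ c %% 3 = 1 ->
    nth false (iter i step x) c (+) nth false (iter i step x) n.-1 =
    nth false (iter i' step x) c (+) nth false (iter i' step x) n.-1.
  move=> cn hc; rewrite !iter_step_passive; [|lia..].
  by case: nth; case: nth; case: odd; case: odd.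
have par i i' : parity (iter i step x) = parity (iter i' step x).
  by rewrite !parity_iter_step.
have pair i i' t : t < h ->
    nth false (iter i step x) (3 * t) (+) nth false (iter i step x) (3 * t + 2) =
    nth false (iter i' step x) (3 * t) (+) nth false (iter i' step x) (3 * t + 2).
  by move=> th; rewrite !iter_step_pair.
have [kl|lk|kl] := ltngtP k l.
- by case: (@walk_simple_ltF (iter j step x) (iter j' step x) k l _
    (par _ _) (pas _ _) (pair _ _)); rewrite ?kl.
- by case: (@walk_simple_ltF (iter j' step x) (iter j step x) l k _
    (par _ _) (pas _ _) (pair _ _)); rewrite ?lk.
by split=> //; apply: (@walk_inj k); rewrite {2}kl.
Qed.

End Walk.

(** * The odometer *)

Section Odometer.
Variables n h : nat.
Hypothesis h_lt : 3 * h < n.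
Implicit Types x y : n.-tuple bool.

(** Adding x_(n-1) cancels the flip that a plain walk makes in direction 3(h-t), so digit t >= 1
    changes only when its triple fires. Digit 0 is x_(n-1) itself and changes at every step. *)
Definition digit x t :=
  (if t is 0 then false else nth false x (3 * (h - t))) (+) nth false x n.-1.

Fixpoint counter x t := if t is s.+1 then counter x s + digit x s * 2 ^ s else 0.

(* Triple i holds digit h - i, so that all lower digits lie beyond it.         *)
Definition carry i x := (counter x (h - i)).+1 == 2 ^ (h - i).

Lemma counter_lt x t : counter x t < 2 ^ t.
Proof. by elim: t => //= t; rewrite expnS; case: digit; lia. Qed.

Lemma eq_counter x y t : (forall s, s < t -> digit x s = digit y s) ->
  counter x t = counter y t.
Proof. by elim: t => //= t IHt H; rewrite IHt ?H // => s st; apply: H; lia. Qed.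

Lemma carry_local i x y : i < h ->
  (forall c, 3 * i + 3 <= c < n -> nth false x c = nth false y c) ->
  carry i x = carry i y.
Proof.
move=> ih H; rewrite /carry (@eq_counter x y) // => s sh.
by rewrite /digit (H n.-1); [case: s sh => [|s] sh //; rewrite H //; lia | lia].
Qed.

Local Notation next := (step h carry).

Lemma digit_step x t : t <= h ->
  digit (next x) t = digit x t (+) ((counter x t).+1 == 2 ^ t).
Proof.
move=> th; rewrite /digit [nth _ _ n.-1]step_passive; [|lia..].
case: t th => [|t] th; first by case: nth.
rewrite /step nth_walk; last by lia.
rewrite (_ : (3 * (h - t.+1) < n)); last by lia.
rewrite /swapped (_ : 3 * (h - t.+1) %/ 3 = h - t.+1); last by lia.
rewrite (_ : 3 * (h - t.+1) %% 3 = 0); last by lia.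
rewrite (_ : swap_time _ _ <= n); last by rewrite /swap_time; case: nth; lia.
rewrite (_ : h - t.+1 < h) /=; last by lia.
rewrite /carry subKn // andbT.
by case: nth; case: nth; case: eqP.
Qed.

Lemma counter_step x t : t <= h.+1 ->
  counter (next x) t = (counter x t).+1 %% 2 ^ t.
Proof.
elim: t => [|t IHt] th; first by rewrite modn1.
rewrite /= IHt 1?ltnW // digit_step //.
have := counter_lt x t; rewrite leq_eqVlt => /orP[/eqP E | lt].
  rewrite E eqxx modnn addbT expnS; case: digit => /=.
    by rewrite mul1n -addSn E addnn -mul2n modnn.
  by rewrite addn0 E mul1n modn_small // mul2n -addnn -addn1 leq_add2l expn_gt0.
rewrite modn_small // (ltn_eqF lt) addbF modn_small ?addSn // expnS.
by case: digit; lia.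
Qed.

Lemma counter_iter_step x j t : t <= h.+1 ->
  counter (iter j next x) t = (counter x t + j) %% 2 ^ t.
Proof.
move=> th; elim: j => [|j IHj]; first by rewrite addn0 modn_small ?counter_lt.
by rewrite iterS counter_step // IHj -addn1 modnDml addn1 addnS.
Qed.

Lemma counter_inj x y t s : counter x t = counter y t -> s < t -> digit x s = digit y s.
Proof.
elim: t => //= t IHt; have := counter_lt x t; have := counter_lt y t.
move=> ly lx E; rewrite ltnS leq_eqVlt => /orP[/eqP -> | st].
  by move: E; case: digit; case: digit => //; lia.
by apply: IHt => //; move: E; case: digit; case: digit; lia.
Qed.

(** Passive coordinates are complemented an even number of times. The counter returns, which
    restores each x_a, and the invariant sums x_a + x_b then restore each x_b. *)
Lemma iter_step_id x : iter (2 ^ h.+1) next x = x.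
Proof.
set y := iter _ _ _.
have odd0 : odd (2 ^ h.+1) = false by rewrite oddX.
have passive c : c < n -> 3 * h <= c \/ c %% 3 = 1 -> nth false y c = nth false x c.
  by move=> cn hc; rewrite iter_step_passive // odd0 addbF.
have eq_counter : counter y h.+1 = counter x h.+1.
  by rewrite counter_iter_step // modnDr modn_small ?counter_lt.
have first i : i < h -> nth false y (3 * i) = nth false x (3 * i).
  move=> ih; have := counter_inj eq_counter (s := h - i).
  rewrite /digit (passive n.-1); [|lia..].
  have -> : h - i = (h - i).-1.+1 by lia.
  have -> : h - (h - i).-1.+1 = i by lia.
  by move/(_ ltac:(lia))/addIb.
apply: eq_tuple_bits => c cn.
have [pc | ac] : (3 * h <= c \/ c %% 3 = 1) \/ c < 3 * h /\ c %% 3 != 1 by lia.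
  exact: passive.
have [c0|c2] : c = 3 * (c %/ 3) \/ c = 3 * (c %/ 3) + 2 by lia.
  by rewrite c0; apply: first; lia.
have := iter_step_pair carry h_lt x (2 ^ h.+1) (i := c %/ 3).
rewrite -/y first; last by lia.
by rewrite -c2 => /(_ ltac:(lia))/addbI.
Qed.

Lemma dvdn_iter_step x j : iter j next x = x -> 2 ^ h.+1 %| j.
Proof.
move/(congr1 (fun z => counter z h.+1)); rewrite counter_iter_step // => /eqP.
rewrite -[X in _ == X](modn_small (counter_lt x h.+1)).
by rewrite -[X in _ == X %[mod _]]addn0 eqn_modDl mod0n.
Qed.

Lemma order_step x : order next x = 2 ^ h.+1.
Proof.
apply/eqP; rewrite eqn_leq; apply/andP; split.
  (* Were the order larger, the index of this iterate in the orbit would be 2^(h+1), yet the iterate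
     is x, of index 0. *)
  rewrite leqNgt; apply/negP => /(findex_iter (f := next)).
  by rewrite iter_step_id findex0; apply/eqP; rewrite eq_sym expn_eq0.
apply: dvdn_leq (order_gt0 _ _) _; apply: (@dvdn_iter_step x).
by apply: iter_order; apply: step_inj => //; apply: carry_local.
Qed.

Lemma iter_step_inj x a b : a < 2 ^ h.+1 -> b < 2 ^ h.+1 ->
  iter a next x = iter b next x -> a = b.
Proof.
rewrite -(order_step x) => /(findex_iter (f := next)) aE /(findex_iter (f := next)) bE E.
by rewrite -aE E bE.
Qed.

Hypothesis n_even : ~~ odd n.

Lemma step_transversal :
  exists rep : 'I_(2 ^ (n - 1 - h.+1)) -> n.-tuple bool,
  [/\ forall i, ~~ parity (rep i),
      forall i j a b, iter a next (rep i) = iter b next (rep j) -> i = j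
    & forall x, ~~ parity x -> exists i a, a < 2 ^ h.+1 /\ x = iter a next (rep i)].
Proof.
have inj_step : injective next by apply: step_inj => //; apply: carry_local.
have sym : connect_sym (frel next) by apply: fconnect_sym.
pose ev := [pred x : n.-tuple bool | ~~ parity x].
have ev_closed : fclosed next ev.
  by move=> x y /eqP <-; rewrite !inE parity_step.
have n_gt0 : 0 < n by lia.
have hn : h.+1 <= n - 1 by lia.
(* All orbits have size 2^(h+1), so the number of roots among the 2^(n-1) even vertices follows by
   division. *)
have card_reps : 2 ^ (n - 1 - h.+1) = #|[predI froots next & ev]|.
  apply/eqP; rewrite -(eqn_pmul2r (expn_gt0 2 h.+1)) -expnD subnK //.
  rewrite -card_even_vertices // -(@fcard_order_set _ _ inj_step (2 ^ h.+1)) //.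
  by apply/subsetP => x _; rewrite inE order_step.
have repP i := enum_valP (cast_ord card_reps i).
exists (fun i => enum_val (cast_ord card_reps i)); split=> [i | i j a b E | x px].
- by have /andP[] := repP i.
- apply: (@cast_ord_inj _ _ card_reps); apply: enum_val_inj.
  have /andP[/eqP <- _] := repP i; have /andP[/eqP <- _] := repP j.
  apply/eqP; rewrite root_connect //.
  apply: connect_trans (fconnect_iter next a _) _.
  by rewrite E sym fconnect_iter.
have rx : root (frel next) x \in [predI froots next & ev].
  apply/andP; split; first exact: roots_root.
  by rewrite /= -(closed_connect ev_closed (connect_root _ x)).
exists (cast_ord (esym card_reps) (enum_rank_in rx (root (frel next) x))).
rewrite cast_ordKV enum_rankK_in //.
have rootx : fconnect next (root (frel next) x) x by rewrite sym connect_root.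
exists (findex next (root (frel next) x) x).
by rewrite -(order_step (root (frel next) x)) findex_max // iter_findex.
Qed.

End Odometer.

(** * Assembling the cycles and the matching *)

Lemma triple_lt_expn h : 3 * h < 2 ^ h.+1.
Proof.
elim: h => // -[|h] // IHh; rewrite expnS.
by have := expn_gt0 2 h; move: IHh; rewrite !expnS; lia.
Qed.

Theorem theorem1p6 (m n : nat) (hm : 1 <= m) (hn : 2 ^ m <= n)
    (n_even : ~~ odd n) :
  exists (C : 'I_(2 ^ (n - 1 - m)) -> graph (n.-tuple bool))
         (e : 'I_(2 ^ (n - 1 - m)) -> 'I_(2 ^ m) -> {set n.-tuple bool}),
    [/\ cycle_decomposition (hypercube n) C,
        forall i, length_of (C i) = 2 ^ m * n,
        forall i,
          [/\ injective (e i),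
              forall j, e i j \in eset (C i)
            & let H := del_edges (C i) [set e i j | j : 'I_(2 ^ m)] in
              #|components H| = 2 ^ m /\
              forall A, A \in components H ->
                is_path (induced H A) /\ length_of (induced H A) = n - 1]
      & perfect_matching (hypercube n)
          [set e i j | i : 'I_(2 ^ (n - 1 - m)), j : 'I_(2 ^ m)]].
Proof.
case: m hm hn => // h _ hn.
(* There is room for h disjoint triples and for direction n-1 beyond them. *)
have h_lt : 3 * h < n := leq_trans (triple_lt_expn h) hn.
have N_gt1 : 1 < 2 ^ h.+1 by rewrite (@ltn_exp2l 2 0).
have n_gt1 : 1 < n := leq_trans N_gt1 hn.
have n1_lt : n.-1 < n by lia.
have loc := @carry_local n h h_lt.
have [rep [rep_even rep_inj rep_onto]] := step_transversal h_lt n_even.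
pose F := @carry n h; pose S := step h F.
pose P i j k := walk h F (iter j S (rep i)) k.
have even_iter i j : ~~ parity (iter j S (rep i)) by rewrite parity_iter_step.
have P_next i j : P i j n = P i j.+1 0 by rewrite /P walk0.
have P_closed i : P i (2 ^ h.+1) 0 = P i 0 0 by rewrite /P iter_step_id.
have P_inj i j k j' k' : j < 2 ^ h.+1 -> k < n -> j' < 2 ^ h.+1 -> k' < n ->
    P i j k = P i j' k' -> j = j' /\ k = k'.
  by move=> jN kn jN' kn' /walk_simple[] // /iter_step_inj ->.
pose E i j k := walk_edge h F (iter j S (rep i)) k.
have E_glob i j k i' j' k' : j < 2 ^ h.+1 -> k < n -> j' < 2 ^ h.+1 -> k' < n ->
    E i j k = E i' j' k' -> [/\ i = i', j = j' & k = k'].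
  move=> jN kn jN' kn' /(walk_edge_inj h_lt loc)[] // xx' ->.
  by have ii' := rep_inj _ _ _ _ xx'; move: xx'; rewrite -ii' => /iter_step_inj ->.
have E_inj i j k j' k' : j < 2 ^ h.+1 -> k < n -> j' < 2 ^ h.+1 -> k' < n ->
    E i j k = E i j' k' -> j = j' /\ k = k'.
  by move=> jN kn jN' kn' /E_glob[].
have E_onto e : e \in cube_edges n ->
    exists i (j : 'I_(2 ^ h.+1)) (k : 'I_n), e = E i j k.
  case/(walk_edge_onto h_lt loc) => x [k [px kn ->]].
  have [i [j [jN ->]]] := rep_onto x px.
  by exists i, (Ordinal jN), (Ordinal kn).
pose C i := block_cycle n_gt1 N_gt1 (P_next i) (P_closed i) (P_inj i).
exists C, (fun i j => E i j n.-1); split.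
- split=> [i | i i' ii' | ].
  + exact: block_is_cycle.
  + rewrite -setI_eq0; apply/eqP/setP => e; rewrite !inE; apply/negP.
    case/andP => /imsetP[[j k] _ ->] /imsetP[[j' k'] _].
    by move=> /E_glob[] // /eqP; rewrite (negPf ii').
  + apply/setP => e; apply/bigcupP/idP => [[i _ /imsetP[[j k] _ ->]] | ].
      exact: walk_edge_cube.
    case/E_onto => i [j [k ->]]; exists i => //.
    by apply/imsetP; exists (j, k).
- by move=> i; apply: block_length; exact: E_inj.
- move=> i; split=> [j j' | j | H].
  + by case/E_inj => // /val_inj.
  + exact: links_sub.
  + split; first by apply: card_del_components; exact: E_inj.
    by apply: del_component_path; exact: E_inj.
have E_last i j : E i j n.-1 = [set P i j n.-1; flip n.-1 (P i j n.-1)].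
  have /eqP d : dir h F (iter j S (rep i)) n.-1 == n.-1 by rewrite dir_last.
  by rewrite /E walk_edgeE // d.
split.
- by apply/subsetP => _ /imset2P[i j _ _ ->]; apply: walk_edge_cube.
- move=> _ _ /imset2P[i j _ _ ->] /imset2P[i' j' _ _ ->].
  rewrite !E_last.
  (* Two edges of direction n-1 with a common vertex coincide, in each of the four ways of sharing
     it. *)
  apply: contraNT => /pred0Pn[z /andP[/= /set2P[] -> /set2P[] E2]].
  + by rewrite E2.
  + by rewrite E2 flipK setUC.
  + by rewrite -E2 flipK setUC.
  + by rewrite (inv_inj (@flipK n n.-1) E2).
move=> x _.
(* The edge of direction n-1 at x lies on some walk, and [dir_last] makes it the last edge there. *)
have /E_onto[i [j [k Ex]]] : [set x; flip n.-1 x] \in cube_edges n.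
  by apply/cube_edgeP; exists x, n.-1.
exists (E i j n.-1); first by apply/imset2P; exists i j.
have kn := ltn_ord k.
move: (Ex); rewrite {1}/E walk_edgeE // => /flip_edge_inj[||/esym/eqP]; rewrite ?dir_lt //.
by rewrite dir_last // => /eqP <- _; rewrite -Ex !inE eqxx.
Qed.
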